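(* Let $K\geq 1$ be an integer and let $F:[0,\infty)^K\to[0,\infty)$ be a generalised e-merging function. Then there is a $K$-tuple $\mathbf w=(w_1,\dots,w_K)\in[0,1]^K$ such that $\sum_{k=1}^K w_k\leq 1$ and, for every $\mathbf u=(u_1,\dots,u_K)\in[0,\infty)^K$, $$F(\mathbf u)\leq 1+\sum_{k=1}^K w_k(u_k-1).$$
   Context: Given a measurable space $\mathcal X$ and a collection $\mathcal H$ of probability measures on $\mathcal X$ (the null hypothesis), an e-variable for $\mathcal H$ is a non-negative measurable function $E:\mathcal X\to[0,\infty)$ such that $\mathbb E_P[E]\leq 1$ for every $P\in\mathcal H$. For an integer $K\geq 1$, a generalised e-merging function is a Borel measurable mapping $F:[0,\infty)^K\to[0,\infty)$ (not assumed monotone) such that, for any measurable space $\mathcal X$, any collection $\mathcal H$ of probability measures on $\mathcal X$, and any $K$-tuple $\mathbf E=(E_1,\dots,E_K)$ of e-variables for $\mathcal H$, the composition $F\circ\mathbf E:x\mapsto F(E_1(x),\dots,E_K(x))$ is again an e-variable for $\mathcal H$. *)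

(* Defs.v *)
From HB Require Import structures.
From mathcomp Require Import all_boot all_order all_algebra.
From mathcomp Require Import all_classical all_reals all_analysis.

Set Implicit Arguments.
Unset Strict Implicit.
Unset Printing Implicit Defensive.

Import Order.TTheory GRing.Theory Num.Theory.
Import numFieldNormedType.Exports.

Local Open Scope classical_set_scope.
Local Open Scope ring_scope.

Definition is_evariable (R : realType) (d : measure_display)
    (X : measurableType d) (H : set (probability X R)) (E : X -> R) : Prop :=
  [/\ measurable_fun [set: X] E,
      (forall x, 0 <= E x) &
      (forall P : probability X R, H P -> ('E_P[E] <= 1)%E)].

Definition nonneg_orthant (R : realType) (K : nat) : set 'rV[R]_K :=
  [set u | forall k, 0 <= u 0 k].

(* A map [0,oo)^K -> [0,oo) is encoded as a total F : 'rV[R]_K -> R of which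
   only the values on the orthant matter. The domain of measurable_fun is R^K
   with the sigma-algebra generated by its open sets; on subsets of the orthant
   this is the Borel sigma-algebra of [0,oo)^K, the orthant being closed.
   Restricting X to a measurableType only excludes the empty space, on which
   there is no probability measure. *)
Definition is_generalised_emerging (R : realType) (K : nat)
    (F : 'rV[R]_K -> R) : Prop :=
  [/\ measurable_fun (T := g_sigma_algebraType (@open 'rV[R]_K))
        (@nonneg_orthant R K) F,
      (forall u, nonneg_orthant u -> 0 <= F u) &
      (forall (d : measure_display) (X : measurableType d)
         (H : set (probability X R)) (E : 'I_K -> X -> R),
         (forall k, is_evariable H (E k)) ->
         is_evariable H (fun x => F (\row_k E k x)))].

(* Main.v *)
(** Testing [F] on the finitely supported probabilities gives
    [\sum p_i F(u_i) <= S] for all weights [p_i >= 0] and points [u_i] of the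
    orthant such that [\sum p_i <= S] and [\sum p_i u_i <= S] coordinatewise:
    divide by [S] and put the missing mass at the origin, where [F >= 0].
    The conditions required of [w] amount to [w . z <= r] for [(z, r)] one of
    [(-e_k, 0)], [(1, 1)] and [(1 - u, 1 - F u)]. In the convex cone spanned by
    these pairs, the above inequality says that [(0, r)] occurs only with
    [r >= 0], and the Hahn-Banach theorem provides [w]. *)

From HB Require Import structures.
Require Import Defs.
From mathcomp Require Import all_boot all_order all_algebra.
From mathcomp Require Import all_classical all_reals all_analysis.
From mathcomp Require Import measurable_realfun ring lra.

Set Implicit Arguments.
Unset Strict Implicit.
Unset Printing Implicit Defensive.

Import Order.TTheory GRing.Theory Num.Theory.
Import numFieldNormedType.Exports.

Local Open Scope classical_set_scope.
Local Open Scope ring_scope.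

(** The witness is the sum of the Dirac masses at [x i] scaled by [p i]; the points may repeat. *)
Lemma finite_mixture (R : realType) (d : measure_display)
    (T : measurableType d) (n : nat) (p : nat -> {nonneg R}) (x : nat -> T) :
  \sum_(i < n) (p i)%:num = 1 ->
  exists P : probability T R, forall f : T -> R,
    measurable_fun [set: T] f -> (forall t, 0 <= f t) ->
    'E_P[f]%E = (\sum_(i < n) (p i)%:num * f (x i))%:E.
Proof.
move=> p1.
pose m i : {measure set T -> \bar R} := mscale (p i) (dirac (x i)).
have mT : msum m n setT = 1%E.
  rewrite /msum -p1 -sumEFin; apply: eq_bigr => i _.
  by rewrite /m /= /mscale /= diracT mule1.
pose P : probability T R :=
  HB.pack (msum m n) (Measure_isProbability.Build _ _ _ (msum m n) mT).
exists P => f mf f0.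
have mEf : measurable_fun [set: T] (fun t => (f t)%:E).
  exact/measurable_EFinP.
rewrite unlock -sumEFin [LHS]ge0_integral_measure_sum//=; last first.
  by move=> t _; rewrite lee_fin.
apply: eq_bigr => i _.
rewrite ge0_integral_mscale//=; last by move=> t _; rewrite lee_fin.
by rewrite integral_dirac// diracT mul1e.
Qed.

Lemma emerging_weighted_sum (R : realType) (K : nat) (F : 'rV[R]_K -> R)
    (s : seq (R * 'rV[R]_K)) (S : R) :
  is_generalised_emerging F ->
  {in s, forall x, 0 <= x.1 /\ nonneg_orthant x.2} ->
  \sum_(x <- s) x.1 <= S ->
  (forall k, \sum_(x <- s) x.1 * x.2 0 k <= S) ->
  \sum_(x <- s) x.1 * F x.2 <= S.
Proof.
move=> [_ F0 Fe] s0 sS usS.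
(* [S] is only known to be nonnegative; enlarging it by an arbitrary [e > 0] allows division by
   it. *)
wlog S0 : S sS usS / 0 < S.
  move=> W; apply/ler_addgt0Pr => e e0; apply: W.
  - by rewrite (le_trans sS)// lerDl ltW.
  - by move=> k; rewrite (le_trans (usS k))// lerDl ltW.
  - rewrite ltr_wpDl// (le_trans _ sS)// big_seq sumr_ge0// => x /s0[].
    by [].
have o0 : nonneg_orthant (0 : 'rV[R]_K) by move=> k; rewrite mxE.
pose t := (S - \sum_(x <- s) x.1, 0) :: s.
(* The default [(0, 0)] satisfies this too, so it holds for every natural number [i]. *)
have t0 i : 0 <= (nth (0, 0) t i).1 /\ nonneg_orthant (nth (0, 0) t i).2.
  have [it|ti] := ltnP i (size t); last by rewrite nth_default//=; split.
  have := mem_nth (0, 0) it; rewrite inE => /predU1P[->/=|/s0//].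
  by rewrite subr_ge0; split.
have p0 i : 0 <= (nth (0, 0) t i).1 / S.
  by rewrite divr_ge0 ?(ltW S0)// (t0 i).1.
have sumE (g : 'rV[R]_K -> R) :
    \sum_(i < size t) (nth (0, 0) t i).1 / S * g (nth (0, 0) t i).2 =
    ((S - \sum_(x <- s) x.1) * g 0 + \sum_(x <- s) x.1 * g x.2) / S.
  transitivity (\sum_(x <- t) x.1 / S * g x.2).
    by rewrite (big_nth (0, 0)) big_mkord.
  rewrite big_cons/= [RHS]mulrDl mulr_suml mulrAC; congr (_ + _).
  by apply: eq_bigr => x _; rewrite mulrAC.
(* The sample space is [nat], the set of positions in [t]: every function on it is measurable, and
   repeated points need no merging. *)
have [|P EP] := @finite_mixture R _ nat (size t) (fun i => NngNum (p0 i)) id.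
  have := sumE (fun=> 1); under eq_bigr do rewrite mulr1.
  move=> /= ->; under [X in _ + X]eq_bigr do rewrite mulr1.
  by rewrite mulr1 subrK divff// gt_eqF.
pose E (k : 'I_K) (i : nat) : R := (nth (0, 0) t i).2 0 k.
have rowE i : \row_k E k i = (nth (0, 0) t i).2 by apply/rowP => k; rewrite mxE.
have [|_ _ /(_ P erefl)] := Fe _ _ [set P] E.
  move=> k; split => //.
    by move=> i; exact: (t0 i).2.
  move=> _ ->; rewrite EP//; last by move=> i; exact: (t0 i).2.
  have /= -> := sumE (fun u : 'rV_K => u 0 k).
  by rewrite mxE mulr0 add0r lee_fin ler_pdivrMr// mul1r.
rewrite EP//; last by move=> i; rewrite rowE; exact/F0/(t0 i).2.
rewrite /=; under eq_bigr do rewrite rowE.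
rewrite sumE lee_fin ler_pdivrMr// mul1r; apply: le_trans.
by rewrite lerDr mulr_ge0 ?subr_ge0//; exact: F0.
Qed.

(* Hahn-Banach in finite dimension, with the sublinear functional replaced by
   its epigraph [C]. The linear form is found one coordinate at a time: its
   value on the next basis vector is the least of the upper bounds which [C]
   imposes on it. *)
Lemma cone_linear_bound (R : realType) (n : nat) (C : set ('rV[R]_n * R)) :
  (forall z r y s, C (z, r) -> C (y, s) -> C (z + y, r + s)) ->
  (forall a z r, 0 < a -> C (z, r) -> C (a *: z, a * r)) ->
  (forall z, exists r, C (z, r)) ->
  (forall r, C (0, r) -> 0 <= r) ->
  exists l : 'cV[R]_n, forall z r, C (z, r) -> (z *m l) 0 0 <= r.
Proof.
move=> CD CZ Ct C0.
(* Induction on [k], the bound being asked only of vectors supported on the first [k]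
   coordinates. *)
suff H k : (k <= n)%N -> exists l : 'cV[R]_n, forall z r, C (z, r) ->
    (forall j : 'I_n, (k <= j)%N -> z 0 j = 0) -> (z *m l) 0 0 <= r.
  have [l lC] := H n (leqnn n); exists l => z r Czr; apply: lC => // j.
  by rewrite leqNgt ltn_ord.
elim: k => [_|k IH kn].
  exists 0 => z r Czr z0; rewrite mulmx0 mxE; apply: C0.
  by rewrite (_ : 0 = z)//; apply/rowP => j; rewrite mxE z0.
have [l lC] := IH (ltnW kn); pose i := Ordinal kn.
pose supp (z : 'rV[R]_n) := forall j : 'I_n, (k < j)%N -> z 0 j = 0.
have suppZ a z : supp z -> supp (a *: z).
  by move=> zk j kj; rewrite mxE zk// mulr0.
have le_lC z r : C (z, r) -> supp z -> z 0 i = 0 -> (z *m l) 0 0 <= r.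
  move=> Czr zk zi; apply: lC => // j; rewrite leq_eqVlt => /predU1P[kj|/zk//].
  by rewrite -zi; congr (z 0 _); apply/val_inj.
pose A := [set a | exists z r,
  [/\ C (z, r), supp z, z 0 i = 1 & a = r - (z *m l) 0 0]].
(* Adding a vector with entry [1] at [i] to one with entry [-1] cancels that entry, so the induction
   hypothesis applies to the sum. *)
have lbA y q : C (y, q) -> supp y -> y 0 i = -1 -> lbound A ((y *m l) 0 0 - q).
  move=> Cyq yk yi _ [z [r [Czr zk zi ->]]].
  have : ((z + y) *m l) 0 0 <= r + q.
    apply: le_lC; [exact: CD| |by rewrite mxE zi yi subrr].
    by move=> j kj; rewrite mxE zk// yk// addr0.
  rewrite mulmxDl mxE; lra.
pose e : 'rV[R]_n := delta_mx 0 i.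
have ek : supp e.
  move=> j kj; rewrite mxE eqxx /= [j == i](_ : _ = false)//.
  by apply/negP => /eqP ji; rewrite ji ltnn in kj.
have ei : e 0 i = 1 by rewrite mxE !eqxx.
have A0 : A !=set0.
  by have [r Cr] := Ct e; exists (r - (e *m l) 0 0), e, r.
have hA : has_lbound A.
  have [q Cq] := Ct (- e); exists (((- e) *m l) 0 0 - q); apply: lbA => //.
    by rewrite -scaleN1r; apply: suppZ.
  by rewrite mxE ei.
(* [l] may already be nonzero at [i]; since [A] subtracts [z *m l], [inf A] is the increment of that
   entry. *)
exists (l + inf A *: delta_mx i 0) => z r Czr zk.
have -> : (z *m (l + inf A *: delta_mx i 0)) 0 0 = (z *m l) 0 0 + inf A * z 0 i.
  by rewrite mulmxDr -scalemxAr -colE !mxE.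
(* Rescaling makes the entry [-1] or [1]: the first case uses that [inf A] is the greatest lower
   bound of [A], the second that it is a lower bound. *)
have [zi0|zi0|zi0] := ltgtP (z 0 i) 0.
- have c0 : 0 < (- z 0 i)^-1 by rewrite invr_gt0 oppr_gt0.
  have : ((((- z 0 i)^-1 *: z) *m l) 0 0 - (- z 0 i)^-1 * r) <= inf A.
    apply: lb_le_inf => //; apply: lbA; [exact: CZ|exact: suppZ|].
    by rewrite mxE invrN mulNr mulVf// lt_eqF.
  rewrite -scalemxAl mxE -mulrBr mulrC ler_pdivrMr ?oppr_gt0//; lra.
- have c0 : 0 < (z 0 i)^-1 by rewrite invr_gt0.
  have : inf A <= (z 0 i)^-1 * r - (((z 0 i)^-1 *: z) *m l) 0 0.
    apply: ge_inf => //; exists ((z 0 i)^-1 *: z), ((z 0 i)^-1 * r).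
    by split => //; [exact: CZ|exact: suppZ|rewrite mxE mulVf// gt_eqF].
  rewrite -scalemxAl mxE -mulrBr mulrC ler_pdivlMr//; lra.
- by rewrite zi0 mulr0 addr0; apply: le_lC.
Qed.

Theorem theorem1 (R : realType) (K : nat) (K_ge1 : (1 <= K)%N)
    (F : 'rV[R]_K -> R) (F_emerging : is_generalised_emerging F) :
  exists w : 'rV[R]_K,
    [/\ (forall k, 0 <= w 0 k <= 1),
        \sum_(k < K) w 0 k <= 1 &
        (forall u : 'rV[R]_K, (forall k, 0 <= u 0 k) ->
           F u <= 1 + \sum_(k < K) w 0 k * (u 0 k - 1))].
Proof.
(* [S] is [\sum p_i] plus the coefficient of the generator [(1, 1)]. *)
pose C := [set c : 'rV[R]_K * R | exists S, exists2 s : seq (R * 'rV[R]_K),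
  {in s, forall x, 0 <= x.1 /\ nonneg_orthant x.2} &
  [/\ \sum_(x <- s) x.1 <= S,
      (forall k, c.1 0 k + \sum_(x <- s) x.1 * x.2 0 k <= S) &
      S - \sum_(x <- s) x.1 * F x.2 <= c.2]].
have nilE (g : R * 'rV[R]_K -> R) : \sum_(x <- [::]) g x = 0 by rewrite big_nil.
have [||||l lC] := @cone_linear_bound R K C.
(* Concatenating the lists adds the two combinations. *)
- move=> z r y q [S [s s0 [sS zS Sr]]] [S' [s' s0' [sS' yS' Sq]]].
  exists (S + S'), (s ++ s').
    by move=> x; rewrite mem_cat => /orP[/s0|/s0'].
  rewrite !big_cat/=; split; [by rewrite lerD| |move: Sr Sq => /=; lra].
  move=> k; rewrite big_cat/= mxE; have := zS k; have := yS' k => /=; lra.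
- move=> a z r a0 [S [s s0 [sS zS Sr]]].
  have sumE (g : 'rV[R]_K -> R) :
      \sum_(x <- [seq (a * x.1, x.2) | x <- s]) x.1 * g x.2 =
      a * \sum_(x <- s) x.1 * g x.2.
    by rewrite big_map/= mulr_sumr; apply: eq_bigr => x _; rewrite mulrA.
  exists (a * S), [seq (a * x.1, x.2) | x <- s].
    by move=> _ /mapP[x /s0[x0 xo] ->]; split => //=; rewrite mulr_ge0// ltW.
  split.
  + by rewrite big_map/= -mulr_sumr ler_pM2l.
  + by move=> k; rewrite (sumE (fun u : 'rV_K => u 0 k)) mxE -mulrDr ler_pM2l.
  + by rewrite sumE -mulrBr ler_pM2l.
(* No test point is needed: the sum of the absolute values dominates each coordinate. *)
- move=> z; exists (\sum_k `|z 0 k|), (\sum_k `|z 0 k|), [::] => //.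
  rewrite !nilE subr0; split => // [|k]; first exact: sumr_ge0.
  rewrite nilE addr0 (bigD1 k)//= (le_trans (ler_norm _))// lerDl.
  exact: sumr_ge0.
(* For [z = 0], membership in [C] supplies exactly the hypotheses of [emerging_weighted_sum]. *)
- move=> r [S [s s0 [sS zS Sr]]]; apply: le_trans Sr; rewrite subr_ge0.
  apply: emerging_weighted_sum => // k.
  by have := zS k; rewrite /= mxE add0r.
have lE (z : 'rV[R]_K) : (z *m l) 0 0 = \sum_k z 0 k * l k 0 by rewrite mxE.
have l0 k : 0 <= l k 0.
  have : ((- delta_mx 0 k : 'rV_K) *m l) 0 0 <= 0.
    apply: lC; exists 0, [::] => //; rewrite !nilE subr0; split => // j.
    by rewrite nilE addr0 !mxE oppr_le0 ler0n.
  by rewrite mulNmx -rowE !mxE oppr_le0.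
have l1 : \sum_k l k 0 <= 1.
  have : ((const_mx 1 : 'rV_K) *m l) 0 0 <= 1.
    apply: lC; exists 1, [::] => //; rewrite !nilE subr0; split => // j.
    by rewrite nilE addr0 mxE.
  by rewrite lE; under eq_bigr do rewrite mxE mul1r.
exists l^T; split.
- move=> k; rewrite mxE l0/= (le_trans _ l1)// (bigD1 k)//= lerDl.
  exact: sumr_ge0.
- by under eq_bigr do rewrite mxE.
move=> u u0.
(* The single point [u] with weight [1] and [S = 1] gives the generator that encodes the claim at
   [u]. *)
have : ((const_mx 1 - u) *m l) 0 0 <= 1 - F u.
  apply: lC; exists 1, [:: (1, u)].
    by move=> x; rewrite inE => /eqP ->; split => //=.
  rewrite !big_seq1 /= mul1r; split => // j.
  by rewrite big_seq1 /= mul1r !mxE subrK.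
rewrite lE; suff -> : \sum_k (const_mx 1 - u) 0 k * l k 0 =
  - \sum_(k < K) l^T 0 k * (u 0 k - 1) by lra.
by rewrite -sumrN; apply: eq_bigr => k _; rewrite !mxE; ring.
Qed.
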